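(* Let $n\ge 2$ and let $\Omega=(a_1,b_1)\times\cdots\times(a_n,b_n)\subset\mathbb{R}^n$ be a bounded box. Suppose there are constants $C_1,C_2,C_3>0$ and a function $f:\Omega\times[0,\infty)\to[0,\infty)$ such that (i) $f(x,s)\ge \lambda s-C_1$ for all $x\in\Omega$, $s\ge 0$, for some $\lambda>\lambda_1:=\sum_{i=1}^n\frac{\pi^2}{(b_i-a_i)^2}$; (ii) $f(x,s)\le C_2 s^p+C_3$ for all $x\in\Omega$, $s\ge0$, for some $p\in(1,\frac{n}{n-1})$. Then there exists a constant $\overline{M}$, independent of the mesh size vector $h$, such that for every admissible $h$ every non-negative solution $u:\overline{\Omega}_h\to[0,\infty)$ of $$-\Delta_h u(x)=f(x,u(x))\ \ (x\in\Omega_h),\qquad u=0\ \text{on }\partial\Omega_h$$ satisfies $\|u\|_\infty=\max_{x\in\overline{\Omega}_h}|u(x)|\le\overline{M}$.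
   Context: A mesh size vector $h=(h_1,\dots,h_n)$, $h_i>0$, is admissible for the box if $a_i=k_ih_i$, $b_i=l_ih_i$ with $k_i,l_i\in\mathbb{Z}$, $l_i-k_i>1$. Let $\mathbb{R}^n_h=\{(h_1z_1,\dots,h_nz_n):z_i\in\mathbb{Z}\}$, $\overline{\Omega}_h=\overline{\Omega}\cap\mathbb{R}^n_h$, $\Omega_h=\Omega\cap\mathbb{R}^n_h$, $\partial\Omega_h=\partial\Omega\cap\mathbb{R}^n_h$. With $\delta_i=h_ie_i$ ($e_i$ the standard basis vectors), the discrete Laplacian is $\Delta_hu(x)=\sum_{i=1}^n\frac{u(x+\delta_i)-2u(x)+u(x-\delta_i)}{h_i^2}$ for $x\in\Omega_h$. *)

(* Defs.v *)
From HB Require Import structures.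
From mathcomp Require Import all_boot all_order all_algebra.
From mathcomp Require Import all_classical all_reals all_analysis.
Set Implicit Arguments. Unset Strict Implicit. Unset Printing Implicit Defensive.
Import Order.TTheory GRing.Theory Num.Theory.
Local Open Scope ring_scope.

Section Defs.
Variables (R : realType) (n : nat).

Definition gpoint := {ffun 'I_n -> R}.

Definition in_box (a b : 'I_n -> R) (x : gpoint) : Prop :=
  forall i, a i < x i < b i.

Definition in_cbox (a b : 'I_n -> R) (x : gpoint) : Prop :=
  forall i, a i <= x i <= b i.

Definition in_lattice (h : 'I_n -> R) (x : gpoint) : Prop :=
  exists z : 'I_n -> int, forall i, x i = (z i)%:~R * h i.

Definition admissible (a b h : 'I_n -> R) : Prop :=
  (forall i, 0 < h i) /\
  exists k l : 'I_n -> int, forall i,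
    a i = (k i)%:~R * h i /\ b i = (l i)%:~R * h i /\ (1 < l i - k i)%R.

Definition grid_int (a b h : 'I_n -> R) (x : gpoint) : Prop :=
  in_box a b x /\ in_lattice h x.
Definition grid_cl (a b h : 'I_n -> R) (x : gpoint) : Prop :=
  in_cbox a b x /\ in_lattice h x.
Definition grid_bd (a b h : 'I_n -> R) (x : gpoint) : Prop :=
  (in_cbox a b x /\ ~ in_box a b x) /\ in_lattice h x.

Definition shift (i : 'I_n) (t : R) (x : gpoint) : gpoint :=
  [ffun j => x j + (if j == i then t else 0)].

Definition lap_h (h : 'I_n -> R) (u : gpoint -> R) (x : gpoint) : R :=
  \sum_(i < n) (u (shift i (h i) x) - 2 * u x + u (shift i (- h i) x)) / (h i ^+ 2).

Definition lambda1 (a b : 'I_n -> R) : R :=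
  \sum_(i < n) pi ^+ 2 / ((b i - a i) ^+ 2).

End Defs.

(* Main.v *)
Require Import Defs.
From HB Require Import structures.
From mathcomp Require Import all_boot all_order all_algebra.
From mathcomp Require Import all_classical all_reals all_analysis.
From mathcomp Require Import zify ring lra.
Import Order.TTheory GRing.Theory Num.Theory.
Import numFieldNormedType.Exports.
Local Open Scope ring_scope.
Set Implicit Arguments. Unset Strict Implicit. Unset Printing Implicit Defensive.

(** Write [E(w)] for the discrete Dirichlet energy, [H] for the volume of a mesh
    cell and [phi] for the product of the sines that vanish on the faces of the
    box. Testing the equation with the discrete ground state [phi], whose
    eigenvalue is at most [lambda1], bounds the weighted sum [H * sum (g * phi)] of
    [g = f(., u)].

    Everything else rests on one inequality that is uniform in the mesh, also
    when the ratios [h_i / h_j] degenerate: for [w] vanishing on the boundary and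
    [gam >= 0],
      [(sum (gam * w^2))^n <= C * H * sum (gam^n * phi) * E(w)^n].
    Indeed Cauchy-Schwarz along the [i]-th axis gives
    [w^2 <= C * sine_i * (i-th energy of the line through the point)]; the
    geometric mean over [i] produces the weight [phi^(1/n)], and Loomis-Whitney
    integrates the product of the line energies.

    Since [p < n/(n-1)], [g^(n-1) <= eps * u^n] where [u] is large. With
    [gam = g/u] on that set, [gam^n <= eps * g], so the energy identity
    [E(u) = sum (g * u)] closes up and bounds [H * E(u)]. Next,
    [gam^n <= eps * u^2] where [u] is large, so the same inequality applied to the
    truncations [(u-k)^+] gives a superlinear recursion for their energies along
    the levels [K * (2 - 2^-j)], which forces [u <= 2 * K]. *)

(** * Hoelder and Loomis-Whitney inequalities *)

Section Roots.
Variables (R : realType) (n : nat).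
Hypothesis n_gt0 : (0 < n)%N.
Implicit Types x y : R.

Definition rootn x : R := x `^ (n%:R^-1).

Lemma rootn_ge0 x : 0 <= rootn x. Proof. exact: powR_ge0. Qed.

Lemma rootnK x : 0 <= x -> rootn x ^+ n = x.
Proof.
move=> x0; rewrite -powR_mulrn ?powR_ge0// -powRrM mulVf ?powRr1//.
by rewrite pnatr_eq0 -lt0n.
Qed.

Lemma rootnM x y : 0 <= x -> 0 <= y -> rootn (x * y) = rootn x * rootn y.
Proof. exact: powRM. Qed.

Lemma ler_rootn x y : 0 <= x -> x <= y -> rootn x <= rootn y.
Proof.
move=> x0 xy; apply: ge0_ler_powR => //; rewrite ?nnegrE ?invr_ge0//.
exact: le_trans xy.
Qed.

Lemma exprn_rootn x : 0 <= x -> rootn (x ^+ n) = x.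
Proof.
move=> x0; rewrite /rootn -powR_mulrn// -powRrM mulfV ?powRr1//.
by rewrite pnatr_eq0 -lt0n.
Qed.

Lemma rootn0 : rootn 0 = 0.
Proof. by rewrite /rootn powR0// invr_neq0// pnatr_eq0 -lt0n. Qed.

End Roots.

(** Apply the arithmetic-geometric mean inequality to the normalised entries [B i t / \sum_t B i t];
    summed over [t], each of them contributes 1, so the averages add up to 1. *)
Lemma rootn_holder (R : realType) (I T : finType) (B : I -> T -> R) :
  (0 < #|I|)%N -> (forall i t, 0 <= B i t) ->
  \sum_t rootn #|I| (\prod_i B i t) <= rootn #|I| (\prod_i \sum_t B i t).
Proof.
move=> I0 B0; set n := #|I|.
have S0 i : 0 <= \sum_t B i t by apply: sumr_ge0.
(* A vanishing sum cannot be normalised, but then [B i t = 0] for every [t] and the left side is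
   zero. *)
have [/forallP /= Spos|/forallPn [i]] := boolP [forall i, 0 < \sum_t B i t]; last first.
  rewrite lt_neqAle S0 andbT negbK => /eqP Si0.
  rewrite big1 ?rootn_ge0// => t _.
  have Bi0 : B i t = 0.
    have : \sum_t B i t == 0 by rewrite -Si0.
    by rewrite psumr_eq0// => /allP/(_ t); rewrite mem_index_enum => /(_ isT)/eqP.
  by rewrite (bigD1 i)//= Bi0 mul0r rootn0.
have PS0 : 0 <= \prod_i \sum_t B i t by apply: prodr_ge0.
have nR : (0 : R) < n%:R by rewrite ltr0n.
have key t : rootn n (\prod_i B i t) <=
    rootn n (\prod_i \sum_t B i t) * (n%:R^-1 * \sum_i (B i t / \sum_t B i t)).
  set mu := n%:R^-1 * _.
  have mu0 : 0 <= mu.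
    by rewrite mulr_ge0 ?invr_ge0 ?ler0n// sumr_ge0// => i _; rewrite divr_ge0.
  rewrite -[mu](@exprn_rootn R n)// -rootnM ?exprn_ge0//.
  apply: ler_rootn; first exact: prodr_ge0.
  have -> : \prod_i B i t = (\prod_i \sum_t B i t) * \prod_i (B i t / \sum_t B i t).
    rewrite -big_split/=; apply: eq_bigr => i _.
    by rewrite mulrC divfK// gt_eqF.
  apply: ler_wpM2l => //; rewrite /mu mulrC.
  by apply: (leif_AGM (fun i _ => divr_ge0 (B0 i t) (S0 i))).1.
apply: (le_trans (ler_sum _ (fun t _ => key t))).
rewrite -mulr_sumr -mulr_sumr exchange_big/=.
under [X in _ * (_ * X) <= _]eq_bigr => i _ do rewrite -mulr_suml mulfV ?gt_eqF//.
by rewrite sumr_const mulVf ?mulr1// gt_eqF.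
Qed.

Section LoomisWhitney.
Variables (R : realType) (I T : finType).
Hypothesis I_gt0 : (0 < #|I|)%N.
Notation grid := {ffun I -> T}.
Implicit Types (J : {set I}) (x y : grid) (f : grid -> R).

Definition upd x j (t : T) : grid := [ffun i => if i == j then t else x i].

(* [y] equals [x] off [J], so that [psum J f x] sums [f] over the coordinates in
   [J], the others being frozen at their values in [x]. *)
Definition agree J x y := [forall i, (i \notin J) ==> (y i == x i)].

Definition psum J f x := \sum_(y | agree J x y) f y.

Lemma psum_ge0 J f x : (forall y, 0 <= f y) -> 0 <= psum J f x.
Proof. by move=> f0; apply: sumr_ge0. Qed.

Lemma psum0 f x : psum finset.set0 f x = f x.
Proof.
rewrite /psum (big_pred1 x)// => y; apply/forallP/eqP => [h|-> i].
  by apply/ffunP => i; have := h i; rewrite inE => /eqP.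
  by rewrite eqxx implybT.
Qed.

Lemma psumT f x : psum finset.setT f x = \sum_y f y.
Proof. by apply: eq_bigl => y; apply/forallP => i; rewrite inE. Qed.

Lemma psumU1 J j f x : j \notin J ->
  psum (j |: J)%SET f x = \sum_t psum J f (upd x j t).
Proof.
move=> jJ; rewrite /psum (partition_big (fun y : grid => y j) predT)//=.
apply: eq_bigr => t _; apply: eq_bigl => y.
apply/andP/forallP => [[/forallP h /eqP yj] i|h].
  apply/implyP => iJ; rewrite ffunE; case: (i =P j) => [->|/eqP ij]; first exact/eqP.
  by have := h i; rewrite !inE (negPf ij) iJ.
have yj : y j == t by have := h j; rewrite jJ ffunE eqxx.
split=> //; apply/forallP => i; apply/implyP; rewrite !inE negb_or => /andP[ij iJ].
by have := h i; rewrite iJ ffunE (negPf ij).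
Qed.

Lemma psum_upd J j f x t : j \in J -> psum J f (upd x j t) = psum J f x.
Proof.
move=> jJ; apply: eq_bigl => y; apply: eq_forallb => i; rewrite ffunE.
by case: (i =P j) => [->|//]; rewrite jJ.
Qed.

(* Finner's argument: coordinate [j] is seen by only [#|I|] of the [#|I|+1]
   factors, since [psum [set j] (F j)] does not depend on it; hence the
   coordinates can be summed out one at a time by Hoelder. *)
Lemma psum_loomis_whitney J (G : grid -> R) (F : I -> grid -> R) x :
  (forall y, 0 <= G y) -> (forall i y, 0 <= F i y) ->
  psum J (fun y => rootn #|I| (G y * \prod_i psum [set i]%SET (F i) y)) x <=
  rootn #|I| (psum J G x * \prod_i psum (i |: J)%SET (F i) x).
Proof.
move=> G0 F0; have [k] := ubnP #|J|; elim: k J x => // k IH J x Jk.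
have [->|[j jJ]] := set_0Vmem J.
  by rewrite !psum0; under [in X in _ <= X]eq_bigr do rewrite finset.setU0.
pose K := (J :\ j)%SET.
have jK : j \notin K by rewrite !inE eqxx.
have JE : J = (j |: K)%SET by rewrite finset.setD1K.
have Kk : (#|K| < k)%N by move: Jk; rewrite JE cardsU1 jK; lia.
rewrite {1}JE psumU1//.
apply: (le_trans (ler_sum _ (fun t _ => IH K (upd x j t) Kk))).
(* The [j]-th factor is constant in [t] and leaves the sum as [c]; the slot it frees is given to
   [G], so exactly [#|I|] factors remain for [rootn_holder]. *)
pose B i t := if i == j then psum K G (upd x j t) else psum (i |: K)%SET (F i) (upd x j t).
have B0 i t : 0 <= B i t by rewrite /B; case: ifP => _; apply: psum_ge0.
pose c := psum J (F j) x.
have c0 : 0 <= c by apply: psum_ge0.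
have PB t : 0 <= \prod_i B i t by apply: prodr_ge0.
have -> : psum J G x * \prod_i psum (i |: J)%SET (F i) x = c * \prod_i \sum_t B i t.
  rewrite (bigD1 j)//= [in RHS](bigD1 j)//= mulrCA; congr (_ * (_ * _)).
  - by rewrite /c JE finset.setUA finset.setUid.
  - by rewrite {1}JE psumU1//; apply: eq_bigr => t _; rewrite /B eqxx.
  - apply: eq_bigr => i ij.
    have -> : (i |: J = j |: (i |: K))%SET by rewrite {1}JE finset.setUCA.
    rewrite psumU1; last by rewrite !inE eq_sym (negPf ij) eqxx.
    by apply: eq_bigr => t _; rewrite /B (negPf ij).
rewrite rootnM//; last by apply: prodr_ge0 => i _; apply: sumr_ge0.
apply: le_trans (ler_wpM2l (rootn_ge0 _ _) (rootn_holder I_gt0 B0)).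
rewrite mulr_sumr; apply: ler_sum => t _; rewrite -rootnM//.
suff -> : psum K G (upd x j t) * \prod_i psum (i |: K)%SET (F i) (upd x j t) =
  c * \prod_i B i t by [].
rewrite (bigD1 j)//= [in RHS](bigD1 j)//= mulrCA; congr (_ * (_ * _)).
- by rewrite psum_upd ?setU11// -JE.
- by rewrite /B eqxx.
- by apply: eq_bigr => i ij; rewrite /B (negPf ij).
Qed.

(** The case where all coordinates are summed out. The point [x0] is only a base for [psum], whose
    value over the full set does not depend on it. *)
Lemma loomis_whitney (x0 : grid) (G : grid -> R) (F : I -> grid -> R) :
  (forall y, 0 <= G y) -> (forall i y, 0 <= F i y) ->
  (\sum_x rootn #|I| (G x * \prod_i psum [set i]%SET (F i) x)) ^+ #|I| <=
  (\sum_x G x) * \prod_i \sum_x F i x.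
Proof.
move=> G0 F0.
have := psum_loomis_whitney finset.setT x0 G0 F0.
rewrite !psumT.
under [in X in _ <= X]eq_bigr do rewrite finset.setUT psumT.
move=> /(lerXn2r #|I|)/= h.
apply: le_trans (h _ _) _.
- by rewrite nnegrE sumr_ge0// => x _; apply: rootn_ge0.
- by rewrite nnegrE rootn_ge0.
rewrite rootnK// mulr_ge0 ?sumr_ge0//.
by apply: prodr_ge0 => i _; apply: sumr_ge0.
Qed.

End LoomisWhitney.

(** * One-dimensional bounds *)

Section SineBounds.
Variable R : realType.
Implicit Types x y : R.

Lemma sin_mean_value y : 0 < y ->
  exists2 c, c \in `]0, y[ & sin y = cos c * y.
Proof.
move=> y0.
have cs : {within `[0, y], continuous (@sin R)}%classic.
  by apply: continuous_subspaceT => x; apply: continuous_sin.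
have [c ci] := MVT y0 (fun x _ => is_derive_sin x) cs.
by rewrite sin0 !subr0 => e; exists c.
Qed.

Lemma sin_le_id y : 0 <= y -> sin y <= y.
Proof.
rewrite le_eqVlt => /predU1P[<-|y0]; first by rewrite sin0.
have [c _ ->] := sin_mean_value y0.
by rewrite -[leRHS]mul1r ler_wpM2r ?cos_le1// ltW.
Qed.

(** The left side is [4 * sin (y / 2) ^+ 2]. This compares the discrete eigenvalue with the
    continuous one in [mu1_le]. *)
Lemma two_sub_two_cos_le y : 0 <= y <= pi -> 2 - 2 * cos y <= y ^+ 2.
Proof.
move=> /andP[y0 ypi].
have -> : cos y = 1 - 2 * sin (y / 2) ^+ 2.
  rewrite [in LHS](_ : y = y / 2 *+ 2); last by rewrite -mulr_natr divfK.
  by rewrite cos_mulr2n cos2sin2 -mulr_natr; ring.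
have s1 : sin (y / 2) <= y / 2 by apply: sin_le_id; lra.
have s0 : 0 <= sin (y / 2) by apply: sin_ge0_pi; lra.
nra.
Qed.

(** The mean value theorem on [[0, y/2]] gives [sin (y/2) >= cos (y/2) * y/2]; doubling the angle,
    [sin y >= y * cos (y/2) ^+ 2 = y * (1 + cos y) / 2]. *)
Lemma sin_ge_half y : 0 <= y <= pi / 2 -> y / 2 <= sin y.
Proof.
move=> /andP[]; rewrite le_eqVlt => /predU1P[<-|y0 ypi]; first by rewrite sin0 mul0r.
have w0 : 0 < y / 2 by lra.
have [c /[!in_itv]/= /andP[c0 cw] sE] := sin_mean_value w0.
have pi0 := pi_gt0 R.
have cc : cos (y / 2) <= cos c.
  by apply: ltW; rewrite ltr_cos ?in_itv/=; lra.
have sy : sin y = 2 * (sin (y / 2) * cos (y / 2)).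
  rewrite [in LHS](_ : y = y / 2 *+ 2); last by rewrite -mulr_natr divfK.
  by rewrite sin_mulr2n -mulr_natr; ring.
have cy : cos y = 2 * cos (y / 2) ^+ 2 - 1.
  rewrite [in LHS](_ : y = y / 2 *+ 2); last by rewrite -mulr_natr divfK.
  by rewrite cos_mulr2n -mulr_natr; ring.
have c1 : 0 <= cos y by apply: cos_ge0_pihalf; lra.
have c2 : 0 <= cos (y / 2) by apply: cos_ge0_pihalf; lra.
have c3 : cos (y / 2) * cos (y / 2) <= cos c * cos (y / 2) by apply: ler_wpM2r.
have c4 : cos (y / 2) ^+ 2 * y <= cos c * cos (y / 2) * y by rewrite expr2 ler_wpM2r// ltW.
rewrite sy sE; nra.
Qed.

(** Factor [sin (pi * x)] into the sines of [pi * x / 2] and [pi * (1 - x) / 2], each in the range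
    of [sin_ge_half], and use [pi >= 2]. This turns the parabolic weight of [discrete_hardy] into a
    factor of the ground state. *)
Lemma parabola_le_sin x : 0 <= x <= 1 -> x * (1 - x) <= 2 * sin (pi * x).
Proof.
move=> /andP[x0 x1]; have pi2 := pi_ge2 R.
have a1 : pi * x / 2 / 2 <= sin (pi * x / 2) by apply: sin_ge_half; nra.
have a2 : pi * (1 - x) / 2 / 2 <= sin (pi * (1 - x) / 2) by apply: sin_ge_half; nra.
have sE : sin (pi * x) = 2 * (sin (pi * x / 2) * sin (pi * (1 - x) / 2)).
  rewrite [in LHS](_ : pi * x = pi * x / 2 *+ 2); last by rewrite -mulr_natr divfK.
  have -> : pi * (1 - x) / 2 = pi / 2 - pi * x / 2 by field.
  by rewrite sin_mulr2n sinB sin_pihalf cos_pihalf -mulr_natr; ring.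
have b1 : x / 2 <= sin (pi * x / 2) by apply: le_trans a1; nra.
have b2 : (1 - x) / 2 <= sin (pi * (1 - x) / 2) by apply: le_trans a2; nra.
have x2 : 0 <= x / 2 by lra.
have x3 : 0 <= (1 - x) / 2 by lra.
have := ler_pM x2 x3 b1 b2; rewrite sE; lra.
Qed.

End SineBounds.

Lemma sqr_sum_le (R : realFieldType) (m p : nat) (a : nat -> R) : (m <= p)%N ->
  (\sum_(m <= s < p) a s) ^+ 2 <= (p - m)%:R * \sum_(m <= s < p) a s ^+ 2.
Proof.
move=> mp; set S := \sum_(m <= s < p) a s; set Q := \sum_(m <= s < p) a s ^+ 2.
set k : R := (p - m)%:R.
have [pm|mp'] := leqP p m.
  by rewrite /S big_geq// expr0n/= mulr_ge0// sumr_ge0// => i _; apply: sqr_ge0.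
have k0 : 0 < k by rewrite ltr0n subn_gt0.
have : 0 <= \sum_(m <= s < p) (k * a s - S) ^+ 2 by apply: sumr_ge0 => i _; apply: sqr_ge0.
have -> : \sum_(m <= s < p) (k * a s - S) ^+ 2 = k * (k * Q - S ^+ 2).
  rewrite (eq_bigr (fun s => k ^+ 2 * a s ^+ 2 + (- (2 * k * S)) * a s + S ^+ 2)) => [|s _]; last by ring.
  rewrite !big_split/= -!mulr_sumr sumr_const_nat -/S -/Q -mulr_natl -/k.
  by ring.
by rewrite pmulr_rge0// subr_ge0.
Qed.

(** Cauchy-Schwarz from either end bounds [v t ^+ 2] by [t] and by [M - t] times the sum; adding
    these with weights [M - t] and [t] gives the claim. *)
Lemma discrete_hardy (R : realFieldType) (M t : nat) (v : nat -> R) :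
  v 0%N = 0 -> v M = 0 -> (t <= M)%N ->
  M%:R * v t ^+ 2 <=
  2 * t%:R * (M - t)%:R * \sum_(0 <= s < M) (v s.+1 - v s) ^+ 2.
Proof.
move=> v0 vM tM; set S := \sum_(0 <= s < M) _.
have SE : S = \sum_(0 <= s < t) (v s.+1 - v s) ^+ 2 + \sum_(t <= s < M) (v s.+1 - v s) ^+ 2.
  by rewrite -big_cat_nat.
have S1 : 0 <= \sum_(0 <= s < t) (v s.+1 - v s) ^+ 2 by apply: sumr_ge0 => i _; apply: sqr_ge0.
have S2 : 0 <= \sum_(t <= s < M) (v s.+1 - v s) ^+ 2 by apply: sumr_ge0 => i _; apply: sqr_ge0.
have := @sqr_sum_le R 0 t (fun s => v s.+1 - v s) (leq0n t).
rewrite telescope_sumr// v0 subr0 subn0 => h1.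
have := @sqr_sum_le R t M (fun s => v s.+1 - v s) tM.
rewrite telescope_sumr// vM sub0r sqrrN => h2.
have t0 : 0 <= t%:R :> R by [].
have t1 : 0 <= (M - t)%:R :> R by [].
have g1 : v t ^+ 2 <= t%:R * S.
  by apply: le_trans h1 _; apply: ler_wpM2l => //; rewrite SE lerDl.
have g2 : v t ^+ 2 <= (M - t)%:R * S.
  by apply: le_trans h2 _; apply: ler_wpM2l => //; rewrite SE lerDr.
rewrite -[X in X%:R * _](subnK tM) natrD.
nra.
Qed.

(** * Energy estimates on the discrete torus *)

Section Torus.
Variables (R : realType) (n N : nat) (M : 'I_n -> nat) (h : 'I_n -> R).
Hypotheses (M_gt1 : forall i, (1 < M i)%N)
  (M_le : forall i, (M i <= N)%N) (h_gt0 : forall i, 0 < h i).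
Notation grid := {ffun 'I_n -> 'I_N.+1}.
Implicit Types (z : grid) (i j : 'I_n) (U V W : grid -> R).

(* The grid is a discrete torus with at least one spare layer in each direction:
   functions vanishing off [inner] do not feel the periodicity, and summation by
   parts has no boundary terms. *)
Definition unit_vec i : grid := [ffun j => if j == i then inord 1 else 0].

Definition inner z := [forall i, (0 < z i < M i)%N].

Definition supported W := forall z, ~~ inner z -> W z = 0.

Definition slope i W z := (W (z + unit_vec i) - W z) / h i.

Definition energy W := \sum_i \sum_z slope i W z ^+ 2.

Definition lap W z :=
  \sum_i (W (z + unit_vec i) - 2 * W z + W (z - unit_vec i)) / h i ^+ 2.

(** The cutoff makes the product vanish on the spare layers beyond [M i], where the sine would
    continue with the wrong sign. At [t = M i] both branches agree, see [sineE]. *)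
Definition sine i (t : nat) : R :=
  if (t < M i)%N then sin (pi * (t%:R / (M i)%:R)) else 0.

Definition ground z := \prod_i sine i (z i).

Definition len i : R := (M i)%:R * h i.

Definition cell := \prod_i h i.

Definition volume := \prod_i len i.

(** Product over the axes of the constants in [directional_hardy]. *)
Definition kap := \prod_i (4 * len i).

Lemma torus_gt1 i : (1 < N.+1)%N.
Proof. exact: leq_trans (M_gt1 i) (leqW (M_le i)). Qed.

Lemma unit_vecE i z j : (z j < N)%N ->
  (z + unit_vec i) j = (if j == i then (z j).+1 else z j) :> nat.
Proof.
move=> zN; rewrite !ffunE /=; case: eqP => [_|_] /=.
  by rewrite inordK ?(torus_gt1 i)// addn1 modn_small.
by rewrite addn0 modn_small// ltnW.
Qed.

Lemma unit_vecN i z j : (0 < z i)%N ->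
  (z - unit_vec i) j = (if j == i then (z j).-1 else z j) :> nat.
Proof.
move=> z0; rewrite !ffunE /=; case: eqP => [->|_] /=.
  rewrite inordK ?(torus_gt1 i)// [X in (_ + X)%N]modn_small; last by rewrite subSS subn0.
  rewrite subSS subn0; move: z0 (ltn_ord (z i)); move: (nat_of_ord (z i)) => t t0 tN.
  have -> : (t + N = t.-1 + N.+1)%N by lia.
  by rewrite modnDr modn_small//; lia.
by rewrite subn0 modnn addn0 modn_small.
Qed.

Lemma len_gt0 i : 0 < len i.
Proof. by rewrite mulr_gt0// ltr0n; have := M_gt1 i; lia. Qed.

Lemma cell_gt0 : 0 < cell. Proof. by apply: prodr_gt0 => i _. Qed.

Lemma volume_gt0 : 0 < volume. Proof. by apply: prodr_gt0 => i _; exact: len_gt0. Qed.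

Lemma kap_gt0 : 0 < kap.
Proof. by apply: prodr_gt0 => i _; rewrite mulr_gt0// len_gt0. Qed.

Lemma energy_ge0 W : 0 <= energy W.
Proof. by apply: sumr_ge0 => i _; apply: sumr_ge0 => z _; apply: sqr_ge0. Qed.

Lemma sine_ge0 i t : 0 <= sine i t.
Proof.
rewrite /sine; case: ifP => // tM; apply: sin_ge0_pi.
have M0 : (0 : R) < (M i)%:R by rewrite ltr0n; lia.
rewrite mulr_ge0 ?pi_ge0 ?divr_ge0//= ger_pMr ?pi_gt0// ler_pdivrMr// mul1r ler_nat.
exact: ltnW.
Qed.

Lemma sine_le1 i t : sine i t <= 1.
Proof. by rewrite /sine; case: ifP => // _; apply: sin_le1. Qed.

Lemma ground_ge0 z : 0 <= ground z.
Proof. by apply: prodr_ge0 => i _; apply: sine_ge0. Qed.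

Lemma ground_le1 z : ground z <= 1.
Proof. by apply: prodr_ile1 => i _; rewrite sine_ge0 sine_le1. Qed.

Lemma ground_supported : supported ground.
Proof.
move=> z /forallPn[i zi]; rewrite /ground (bigD1 i)//= /sine.
case: ltnP => zM; rewrite ?mul0r//.
have -> : (z i : nat) = 0%N by move: zi; rewrite zM andbT; lia.
by rewrite mul0r mulr0 sin0 mul0r.
Qed.

Lemma sum_inner_le : cell * \sum_(z | inner z) 1 <= volume.
Proof.
have -> : \sum_(z | inner z) (1 : R) = \prod_i \sum_(t < N.+1) ((0 < t < M i)%N)%:R.
  rewrite bigA_distr_bigA/= big_mkcond/=; apply: eq_bigr => z _.
  case: ifPn => [/forallP zi|/forallPn[i zi]].
    by rewrite big1// => i _; rewrite zi.
  by rewrite (bigD1 i)//= (negPf zi) mul0r.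
rewrite /volume /len big_split/= mulrC ler_wpM2r ?(ltW cell_gt0)//.
apply: ler_prod => i _; rewrite sumr_ge0//=.
rewrite -natr_sum ler_nat -(big_mkord xpredT (fun t => ((0 < t < M i)%N : nat))).
rewrite (@big_cat_nat _ _ _ (M i))//=; last by have := M_le i; lia.
rewrite [X in (_ + X)%N]big_nat_cond [X in (_ + X)%N]big1 => [|t]; last first.
  by rewrite andbT => /andP[Mt _]; rewrite [(t < _)%N]ltnNge Mt andbF.
rewrite addn0; apply: (@leq_trans (\sum_(0 <= t < M i) 1)%N).
  by apply: leq_sum => t _; exact: leq_b1.
by rewrite sum_nat_const_nat muln1 subn0.
Qed.

Lemma sum_by_parts U V :
  \sum_z - lap U z * V z = \sum_i \sum_z slope i U z * slope i V z.
Proof.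
under eq_bigr => z _ do rewrite /lap -sumrN mulr_suml.
rewrite exchange_big/=; apply: eq_bigr => i _.
have hi : h i != 0 by rewrite gt_eqF.
have -> : \sum_(z : grid) - ((U (z + unit_vec i) - 2 * U z + U (z - unit_vec i)) / h i ^+ 2) * V z =
  \sum_(z : grid) (U z - U (z + unit_vec i)) * V z / h i ^+ 2
  + \sum_(z : grid) (U z - U (z - unit_vec i)) * V z / h i ^+ 2.
  by rewrite -big_split/=; apply: eq_bigr => z _; field.
(* Translation is a bijection of the torus, so backward differences become forward ones. *)
rewrite [X in _ + X](reindex_inj (addIr (unit_vec i)))/= -big_split/=.
by apply: eq_bigr => z _; rewrite addrK /slope; field.
Qed.

(* Tests the equation with the truncation [(U - k)^+]. *)
Lemma truncation_energy U (g : grid -> R) k : 0 <= k -> (forall z, 0 <= U z) ->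
  supported U -> (forall z, inner z -> - lap U z = g z) ->
  energy (fun z => Num.max (U z - k) 0) <= \sum_z g z * Num.max (U z - k) 0.
Proof.
move=> k0 U0 Us Ug; set W := fun z => _.
have -> : \sum_z g z * Num.max (U z - k) 0 = \sum_z - lap U z * W z.
  apply: eq_bigr => z _; have [/Ug ->//|/Us Uz] := boolP (inner z).
  by rewrite /W Uz sub0r max_r ?mulr0// oppr_le0.
rewrite sum_by_parts; apply: ler_sum => i _; apply: ler_sum => z _.
rewrite /slope /W expr2 !mulrA ler_wpM2r ?invr_ge0 ?(ltW (h_gt0 i))//.
rewrite -!mulrA ![(h i)^-1 * _]mulrC !mulrA ler_wpM2r ?invr_ge0 ?(ltW (h_gt0 i))//.
(* Truncation is nondecreasing and 1-Lipschitz, so the squared increment of [W] is at most the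
   product of the increments of [U] and [W]. *)
set a := U (z + _); set b := U z; rewrite /Num.max; do 2 case: ltP => ?; nra.
Qed.

Lemma supported_truncation U k : 0 <= k -> supported U ->
  supported (fun z => Num.max (U z - k) 0).
Proof. by move=> k0 Us z /Us ->; rewrite sub0r max_r// oppr_le0. Qed.

Lemma psum_single (f : grid -> R) i z :
  psum [set i]%SET f z = \sum_(t < N.+1) f (upd z i t).
Proof.
rewrite -[[set i]%SET]finset.setU0 psumU1 ?inE//.
by apply: eq_bigr => t _; rewrite psum0.
Qed.

(** This is [discrete_hardy] on the line through [z] in direction [i], with the parabola replaced by
    the sine. The 4 is the product of the factors 2 in [discrete_hardy] and [parabola_le_sin]. *)
Lemma directional_hardy W i z : supported W -> inner z ->
  W z ^+ 2 <= 4 * len i * (sine i (z i) * (h i * psum [set i]%SET (fun y => slope i W y ^+ 2) z)).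
Proof.
move=> Ws /forallP zi; have /andP[zi0 ziM] := zi i.
pose v t := W (upd z i (inord t)).
have MN := M_le i.
have M0 : (0 : R) < (M i)%:R by rewrite ltr0n; lia.
have v0 : v 0%N = 0.
  by apply: Ws; apply/forallPn; exists i; rewrite ffunE eqxx inordK.
have vM : v (M i) = 0.
  by apply: Ws; apply/forallPn; exists i; rewrite ffunE eqxx inordK ?ltnS// ltnn andbF.
have vz : v (z i) = W z.
  by congr W; apply/ffunP => j; rewrite ffunE; case: eqP => [->|//]; rewrite inord_val.
have := discrete_hardy v0 vM (ltnW ziM); rewrite vz.
set S := \sum_(0 <= s < M i) _.
(* The full line of the torus contains the [M i] steps of [S]; its further terms are squares. *)
have SL : S <= h i ^+ 2 * psum [set i]%SET (fun y => slope i W y ^+ 2) z.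
  have vS s : (s < M i)%N -> (v s.+1 - v s) ^+ 2 = h i ^+ 2 * slope i W (upd z i (inord s)) ^+ 2.
    move=> sM; rewrite /slope expr_div_n mulrCA mulfV ?mulr1 ?expf_neq0 ?gt_eqF//.
    congr ((W _ - _) ^+ 2); apply/ffunP => j; apply/val_inj => /=.
    have zN : (upd z i (inord s) j < N)%N.
      rewrite ffunE; case: (j =P i) => _; first by rewrite inordK; lia.
      by have /andP[_ zM] := zi j; exact: leq_trans zM (M_le j).
    rewrite [RHS](unit_vecE _ zN) !ffunE; case: (j =P i) => // _.
    by rewrite !inordK//; lia.
  rewrite psum_single mulr_sumr.
  rewrite /S (eq_big_nat _ _ (F2 := fun s => h i ^+ 2 * slope i W (upd z i (inord s)) ^+ 2)); last first.
    by move=> s /andP[_ sM]; exact: vS.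
  rewrite [leRHS](eq_bigr (fun t : 'I_N.+1 => h i ^+ 2 * slope i W (upd z i (inord t)) ^+ 2)); last first.
    by move=> t _; rewrite inord_val.
  rewrite -(big_mkord xpredT (fun s => h i ^+ 2 * slope i W (upd z i (inord s)) ^+ 2)).
  rewrite [leRHS](@big_cat_nat _ _ _ (M i))//=; last by lia.
  by rewrite lerDl sumr_ge0// => s _; rewrite mulr_ge0 ?sqr_ge0.
set P := psum _ _ _ in SL *.
have x01 : 0 <= ((z i)%:R / (M i)%:R : R) <= 1.
  by rewrite divr_ge0//= ler_pdivrMr// mul1r ler_nat ltnW.
have := parabola_le_sin x01; set x := _ / _ in x01 *.
have sE : sin (pi * x) = sine i (z i) by rewrite /sine ziM.
have -> : (M i - z i)%:R = (M i)%:R * (1 - x) :> R.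
  by rewrite natrB ?(ltnW ziM)// /x mulrBr mulr1 mulrCA mulfV ?mulr1// gt_eqF.
have -> : (z i)%:R = (M i)%:R * x :> R by rewrite /x mulrCA mulfV ?mulr1// gt_eqF.
rewrite sE => hs hW.
have S0 : 0 <= S by apply: sumr_ge0 => s _; apply: sqr_ge0.
have h1 : x * (1 - x) * S <= 2 * sine i (z i) * (h i ^+ 2 * P).
  apply: le_trans (ler_wpM2l _ SL); last by rewrite mulr_ge0 ?sine_ge0.
  exact: ler_wpM2r.
rewrite -(ler_pM2l M0); apply: le_trans hW _.
have -> : 2 * ((M i)%:R * x) * ((M i)%:R * (1 - x)) * S = 2 * (M i)%:R ^+ 2 * (x * (1 - x) * S) by ring.
apply: le_trans (ler_wpM2l _ h1) _; first by rewrite mulr_ge0// sqr_ge0.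
by rewrite /len le_eqVlt; apply: predU1l; ring.
Qed.

(** * The discrete ground state and its eigenvalue *)

Lemma sineE i t : (t <= M i)%N -> sine i t = sin (pi * (t%:R / (M i)%:R)).
Proof.
rewrite leq_eqVlt /sine => /predU1P[->|->//].
by rewrite ltnn mulfV ?mulr1 ?sinpi// pnatr_eq0; have := M_gt1 i; lia.
Qed.

Lemma sine_second_difference i t : (0 < t < M i)%N ->
  sine i t.+1 - 2 * sine i t + sine i t.-1 = - (2 - 2 * cos (pi / (M i)%:R)) * sine i t.
Proof.
case: t => // t /andP[_ tM] /=; rewrite !sineE ?(ltnW tM) ?(ltnW (ltnW tM))//.
have M0 : ((M i)%:R : R) != 0 by rewrite pnatr_eq0; have := M_gt1 i; lia.
set a := pi * (t.+1%:R / _); set b := pi / _.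
have -> : pi * (t.+2%:R / (M i)%:R) = a + b by rewrite /a /b -[t.+2]addn1 natrD; field.
have -> : pi * (t%:R / (M i)%:R) = a - b by rewrite /a /b -[t.+1]addn1 natrD; field.
by rewrite sinD sinB; ring.
Qed.

Definition mu1 : R := \sum_i (2 - 2 * cos (pi / (M i)%:R)) / h i ^+ 2.

Lemma lap_ground z : inner z -> - lap ground z = mu1 * ground z.
Proof.
move=> /forallP zi; rewrite /lap -sumrN /mu1 mulr_suml; apply: eq_bigr => i _.
have zN j : (z j < N)%N by have /andP[_ zM] := zi j; exact: leq_trans zM (M_le j).
have z0 j : (0 < z j)%N by have /andP[] := zi j.
pose c := \prod_(j | j != i) sine j (z j).
have -> : ground z = sine i (z i) * c by rewrite /ground (bigD1 i).
have -> : ground (z + unit_vec i) = sine i (z i).+1 * c.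
  rewrite /ground (bigD1 i)//= unit_vecE ?eqxx//; congr (_ * _).
  by apply: eq_bigr => j /negPf ji; rewrite unit_vecE ?ji.
have -> : ground (z - unit_vec i) = sine i (z i).-1 * c.
  rewrite /ground (bigD1 i)//= unit_vecN ?eqxx//; congr (_ * _).
  by apply: eq_bigr => j /negPf ji; rewrite unit_vecN ?ji.
have := sine_second_difference (zi i).
set s := sine i (z i); set s1 := sine i _; set s2 := sine i _ => e.
have -> : s1 * c - 2 * (s * c) + s2 * c = (s1 - 2 * s + s2) * c by ring.
by rewrite e; field; rewrite gt_eqF.
Qed.

Lemma mu1_le : mu1 <= \sum_i pi ^+ 2 / len i ^+ 2.
Proof.
apply: ler_sum => i _; have M0 : (0 : R) < (M i)%:R by rewrite ltr0n; have := M_gt1 i; lia.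
have -> : pi ^+ 2 / len i ^+ 2 = (pi / (M i)%:R) ^+ 2 / h i ^+ 2.
  by rewrite /len; field; rewrite !gt_eqF.
rewrite ler_wpM2r ?invr_ge0 ?sqr_ge0// two_sub_two_cos_le//.
rewrite divr_ge0 ?pi_ge0//= ler_pdivrMr// ler_peMr ?pi_ge0//.
by rewrite ler1n; have := M_gt1 i; lia.
Qed.

(** * Estimates for a non-negative solution [U] with right-hand side [g] *)

Variables (U g : grid -> R).
Hypotheses (U_ge0 : forall z, 0 <= U z) (U_supp : supported U)
  (g_ge0 : forall z, 0 <= g z)
  (U_eq : forall z, inner z -> - lap U z = g z).

Lemma ground_test : \sum_z g z * ground z = mu1 * \sum_z U z * ground z.
Proof.
have -> : \sum_z g z * ground z = \sum_z - lap U z * ground z.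
  apply: eq_bigr => z _; have [/U_eq ->//|zi] := boolP (inner z).
  by rewrite ground_supported// !mulr0.
have -> : \sum_z - lap U z * ground z = \sum_z - lap ground z * U z.
  rewrite !sum_by_parts; apply: eq_bigr => i _; apply: eq_bigr => z _.
  by rewrite mulrC.
rewrite mulr_sumr; apply: eq_bigr => z _.
have [/lap_ground ->|/U_supp ->] := boolP (inner z); last by rewrite mul0r !mulr0.
by rewrite mulrAC mulrA.
Qed.

(** The tested sum is at most [lam1 * S] by [ground_test] and at least [lam * S] minus a volume term
    by the lower bound on [g]; the gap [lam - lam1] bounds [S]. *)
Lemma weighted_l1_bound (lam lam1 C : R) : 0 <= C -> 0 <= lam1 ->
  \sum_i pi ^+ 2 / len i ^+ 2 <= lam1 -> lam1 < lam ->
  (forall z, inner z -> lam * U z - C <= g z) ->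
  cell * \sum_z g z * ground z <= lam1 * (C * volume / (lam - lam1)).
Proof.
move=> C0 l0 l1 l1l gl; have c0 := cell_gt0.
set S := \sum_z U z * ground z.
have S0 : 0 <= S by apply: sumr_ge0 => z _; rewrite mulr_ge0 ?ground_ge0.
have up : \sum_z g z * ground z <= lam1 * S.
  by rewrite ground_test ler_wpM2r// (le_trans mu1_le).
have low : lam * S - C * \sum_(z | inner z) 1 <= \sum_z g z * ground z.
  rewrite /S !mulr_sumr [X in _ - X]big_mkcond/= -sumrB; apply: ler_sum => z _.
  case: ifPn => [zi|/ground_supported ->]; last by rewrite !mulr0 subr0.
  have := gl z zi; have := ground_ge0 z; have := ground_le1 z.
  move: (ground z) (g z) (U z) => a b d; nra.
have si := sum_inner_le.
have lS : (lam - lam1) * (cell * S) <= C * volume.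
  have : cell * (lam * S - C * \sum_(z | inner z) 1) <= cell * (lam1 * S).
    by rewrite ler_pM2l// (le_trans low).
  have := ler_wpM2l C0 si; lra.
apply: le_trans (_ : cell * (lam1 * S) <= _); first by rewrite ler_pM2l.
rewrite mulrCA ler_wpM2l// ler_pdivlMr ?subr_gt0//; lra.
Qed.

Hypothesis n_gt0 : (0 < n)%N.

Lemma weighted_sobolev W (gam : grid -> R) : supported W -> (forall z, 0 <= gam z) ->
  (\sum_z gam z * W z ^+ 2) ^+ n <=
  kap * cell * (\sum_z gam z ^+ n * ground z) * energy W ^+ n.
Proof.
move=> Ws gam0.
pose F i y := slope i W y ^+ 2.
have F0 i y : 0 <= F i y by apply: sqr_ge0.
(* [G] gathers all that is not a line sum; the product of the directional bounds then dominates
   [gam * W^2] by the summand of [loomis_whitney]. *)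
pose G z := kap * cell * (gam z ^+ n * ground z).
have kc : 0 <= kap * cell by rewrite mulr_ge0 ?(ltW kap_gt0)// ltW// cell_gt0.
have G0 z : 0 <= G z by rewrite mulr_ge0// mulr_ge0 ?exprn_ge0 ?ground_ge0.
have I0 : (0 < #|'I_n|)%N by rewrite card_ord.
have := loomis_whitney I0 0 G0 F0; rewrite card_ord => LW.
have step z : gam z * W z ^+ 2 <= rootn n (G z * \prod_i psum [set i]%SET (F i) z).
  have P0 : 0 <= \prod_i psum [set i]%SET (F i) z by apply: prodr_ge0 => i _; apply: psum_ge0.
  have [zi|/Ws ->] := boolP (inner z); last first.
    by rewrite expr0n/= mulr0 rootn_ge0.
  rewrite -[leLHS](@exprn_rootn _ n)//; last by rewrite mulr_ge0// sqr_ge0.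
  apply: ler_rootn; first by rewrite exprn_ge0// mulr_ge0// sqr_ge0.
  rewrite exprMn.
  have : (W z ^+ 2) ^+ n <= \prod_i (4 * len i * (sine i (z i) * (h i * psum [set i]%SET (F i) z))).
    rewrite -[n in leLHS]card_ord -prodr_const; apply: ler_prod => i _.
    by rewrite sqr_ge0/= directional_hardy.
  have -> : \prod_i (4 * len i * (sine i (z i) * (h i * psum [set i]%SET (F i) z))) =
      kap * (ground z * (cell * \prod_i psum [set i]%SET (F i) z)).
    by rewrite /kap /ground /cell -!big_split.
  move=> /(ler_wpM2l (exprn_ge0 n (gam0 z))) hW; apply: le_trans hW _.
  by rewrite /G le_eqVlt; apply: predU1l; ring.
have h1 : (\sum_z gam z * W z ^+ 2) ^+ n <= (\sum_z rootn n (G z * \prod_i psum [set i]%SET (F i) z)) ^+ n.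
  apply: lerXn2r; rewrite ?nnegrE; last exact: ler_sum.
    by apply: sumr_ge0 => z _; rewrite mulr_ge0// sqr_ge0.
  by apply: sumr_ge0 => z _; exact: rootn_ge0.
apply: le_trans h1 _; apply: le_trans LW _.
rewrite /G -mulr_sumr; apply: ler_wpM2l.
  by rewrite mulr_ge0// sumr_ge0// => z _; rewrite mulr_ge0 ?exprn_ge0 ?ground_ge0.
rewrite -[n in leRHS]card_ord -prodr_const; apply: ler_prod => i _.
rewrite sumr_ge0//= /energy (bigD1 i)//= lerDl sumr_ge0// => j _.
by apply: sumr_ge0 => z _; exact: sqr_ge0.
Qed.

(** This is [weighted_sobolev] with the indicator of the inner points as [gam]. *)
Lemma poincare W : supported W ->
  \sum_z W z ^+ 2 <= (1 + kap * volume) * energy W.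
Proof.
move=> Ws; pose gam z : R := (inner z)%:R.
have gam0 z : 0 <= gam z by [].
have := weighted_sobolev Ws gam0.
have -> : \sum_z gam z * W z ^+ 2 = \sum_z W z ^+ 2.
  apply: eq_bigr => z _; rewrite /gam; have [_|/Ws ->] := boolP (inner z).
    by rewrite mul1r.
  by rewrite expr0n/= mulr0.
have kv : 0 < kap * volume by rewrite mulr_gt0 ?kap_gt0 ?volume_gt0.
move=> hs; rewrite -(@ler_pXn2r _ n)// ?nnegrE; first last.
- by rewrite mulr_ge0 ?energy_ge0//; lra.
- by apply: sumr_ge0 => z _; exact: sqr_ge0.
apply: le_trans hs _; rewrite exprMn ler_wpM2r ?exprn_ge0 ?energy_ge0//.
have h1 : kap * cell * (\sum_z gam z ^+ n * ground z) <= kap * volume.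
  rewrite -mulrA; apply: ler_wpM2l; first by rewrite ltW// kap_gt0.
  apply: le_trans sum_inner_le; apply: ler_wpM2l; first by rewrite ltW// cell_gt0.
  rewrite [leRHS]big_mkcond/=; apply: ler_sum => z _; rewrite /gam.
  case: ifP => _; last by rewrite expr0n gtn_eqF// mul0r.
  by rewrite expr1n mul1r ground_le1.
(* A base at least 1 is below its [n]-th power; the added 1 thus avoids an [n]-th root in the
   constant. *)
apply: le_trans h1 _; apply: le_trans (_ : 1 + kap * volume <= _); first by rewrite lerDr.
rewrite -{1}[1 + _]expr1; apply: ler_weXn2l => //; lra.
Qed.

Lemma energy_bound (Q K eps B : R) : 0 < K -> 0 <= eps -> 0 <= B ->
  cell * \sum_z g z * ground z <= Q ->
  (forall z, inner z -> K <= U z -> g z ^+ n.-1 <= eps * U z ^+ n) ->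
  (forall z, inner z -> U z <= K -> g z <= B) ->
  kap * eps * Q <= 2^-1 ^+ n ->
  cell * energy U <= 2 * (volume * (B * K)).
Proof.
move=> K0 e0 B0 gQ gbig gsmall small; have c0 := cell_gt0.
have k0 := kap_gt0.
pose gam z := if inner z && (K <= U z) then g z / U z else 0.
have gam0 z : 0 <= gam z by rewrite /gam; case: ifP => // _; rewrite divr_ge0.
have EE : energy U = \sum_z g z * U z.
  transitivity (\sum_z - lap U z * U z).
    by rewrite sum_by_parts; apply: eq_bigr => i _; apply: eq_bigr => z _.
  apply: eq_bigr => z _; have [/U_eq ->//|/U_supp ->] := boolP (inner z).
  by rewrite !mulr0.
have split_le : energy U <= \sum_z gam z * U z ^+ 2 + B * K * \sum_(z | inner z) 1.
  rewrite EE mulr_sumr [X in _ + X]big_mkcond/= -big_split/=.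
  apply: ler_sum => z _; rewrite /gam; case: (boolP (inner z)) => [zi|/U_supp ->]/=; last first.
    by rewrite expr0n/= !mulr0 addr0.
  rewrite mulr1; case: (lerP K (U z)) => [KU|/ltW UK]; last first.
    by rewrite mul0r add0r ler_pM// gsmall.
  have U0 : U z != 0 by rewrite gt_eqF// (lt_le_trans K0).
  have -> : g z / U z * U z ^+ 2 = g z * U z by field.
  by rewrite lerDl mulr_ge0// ltW.
(* The region of large [U] costs at most half the energy and is absorbed; elsewhere [g * U <= B * K]
   pointwise. *)
have half : \sum_z gam z * U z ^+ 2 <= 2^-1 * energy U.
  rewrite -(@ler_pXn2r _ n)// ?nnegrE; first last.
  - by rewrite mulr_ge0 ?energy_ge0.
  - by apply: sumr_ge0 => z _; rewrite mulr_ge0 ?sqr_ge0.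
  apply: le_trans (weighted_sobolev U_supp gam0) _.
  rewrite exprMn ler_wpM2r ?exprn_ge0 ?energy_ge0//.
  apply: le_trans small; rewrite -!mulrA ler_wpM2l ?(ltW k0)//.
  apply: le_trans (ler_wpM2l e0 gQ).
  rewrite [leRHS]mulrCA ler_wpM2l ?(ltW c0)// mulr_sumr; apply: ler_sum => z _.
  rewrite mulrA ler_wpM2r ?ground_ge0//.
  rewrite /gam; case: ifP => [/andP[zi KU]|_]; last first.
    by rewrite expr0n gtn_eqF// mulr_ge0.
  have U0 : 0 < U z by rewrite (lt_le_trans K0).
  rewrite expr_div_n ler_pdivrMr ?exprn_gt0// -{1}(prednK n_gt0) exprS.
  by rewrite mulrAC [leRHS]mulrC ler_wpM2l// gbig.
have si := ler_wpM2l (mulr_ge0 B0 (ltW K0)) sum_inner_le.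
have : cell * energy U <= cell * (2 * (B * K * \sum_(z | inner z) 1)).
  by rewrite ler_pM2l//; lra.
lra.
Qed.

Let trunc k : grid -> R := fun z => Num.max (U z - k) 0.

Lemma truncation_energy_le k : energy (trunc k) <= energy U.
Proof.
apply: ler_sum => i _; apply: ler_sum => z _; rewrite /slope !expr_div_n.
rewrite ler_wpM2r ?invr_ge0 ?sqr_ge0// /trunc.
move: (U _) (U _) => a b; rewrite /Num.max.
by do 2 case: ltP => ?; rewrite ?subrr ?expr0n ?sqr_ge0//; nra.
Qed.

(** Where [U > m], [U <= q * (U - k)] with [q = m / (m - k)]. This is used once in the energy, then
    raised to the power [n], and twice in [gam^n <= eps * U^2], hence the exponent [n + 2]. Of the
    [n + 1] energies on the right, [n] come from [weighted_sobolev] and one from [poincare]. *)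
Lemma de_giorgi_step (K eps k m : R) : 0 < K -> 0 <= eps -> K <= k -> k < m ->
  (forall z, inner z -> K <= U z -> g z ^+ n <= eps * U z ^+ n.+2) ->
  (cell * energy (trunc m)) ^+ n <=
  (m / (m - k)) ^+ n.+2 * (kap * (1 + kap * volume) * eps) *
    (cell * energy (trunc k)) ^+ n.+1.
Proof.
move=> K0 e0 Kk km gbig; have c0 := cell_gt0.
have kp0 := kap_gt0.
have k0 : 0 < k by exact: lt_le_trans Kk.
have m0 : 0 < m by exact: lt_trans km.
have mk0 : 0 < m - k by rewrite subr_gt0.
set q := m / (m - k).
have q0 : 0 <= q by rewrite divr_ge0// ltW.
have qU z : m < U z -> U z <= q * (U z - k).
  by move=> mU; rewrite /q mulrAC ler_pdivlMr//; nra.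
have Wk z : m < U z -> trunc k z = U z - k.
  by move=> mU; rewrite /trunc max_l// subr_ge0 ltW// (lt_trans km).
pose gam z := if inner z && (m < U z) then g z / U z else 0.
have gam0 z : 0 <= gam z by rewrite /gam; case: ifP => // _; rewrite divr_ge0.
have Ek0 : 0 <= energy (trunc k) by exact: energy_ge0.
have Ws := supported_truncation (ltW k0) U_supp.
have E1 : energy (trunc m) <= q * \sum_z gam z * trunc k z ^+ 2.
  apply: le_trans (truncation_energy (ltW m0) U_ge0 U_supp U_eq) _.
  rewrite mulr_sumr; apply: ler_sum => z _.
  have rhs0 : 0 <= q * (gam z * trunc k z ^+ 2) by rewrite mulr_ge0// mulr_ge0// sqr_ge0.
  have [zi|/U_supp Uz] := boolP (inner z); last first.
    by rewrite Uz sub0r max_r ?mulr0// oppr_le0 ltW.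
  have [mU|Um] := ltP m (U z); last by rewrite max_r ?mulr0// subr_le0.
  have U0 : 0 < U z by exact: lt_trans mU.
  rewrite /gam zi mU/= (Wk _ mU) max_l ?subr_ge0 ?(ltW mU)//.
  have -> : q * (g z / U z * (U z - k) ^+ 2) = g z * (U z - k) * (q * (U z - k) / U z).
    by field; rewrite gt_eqF.
  have h1 : 1 <= q * (U z - k) / U z by rewrite ler_pdivlMr// mul1r qU.
  have h2 : g z * (U z - m) <= g z * (U z - k) by rewrite ler_wpM2l// lerD2l lerN2 ltW.
  apply: le_trans h2 _; rewrite ler_peMr// mulr_ge0// subr_ge0 ltW// (lt_trans km)//.
have E2 : \sum_z gam z ^+ n * ground z <= eps * q ^+ 2 * ((1 + kap * volume) * energy (trunc k)).
  apply: le_trans (ler_wpM2l _ (poincare Ws)); last first.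
    by rewrite mulr_ge0// sqr_ge0.
  rewrite mulr_sumr; apply: ler_sum => z _.
  have gn0 : 0 <= gam z ^+ n by rewrite exprn_ge0.
  apply: le_trans (_ : gam z ^+ n <= _); first by rewrite ler_piMr// ground_le1.
  rewrite /gam; case: ifP => [/andP[zi mU]|_]; last first.
    by rewrite expr0n gtn_eqF// mulr_ge0 ?sqr_ge0// mulr_ge0 ?sqr_ge0.
  have U0 : 0 < U z by exact: lt_trans mU.
  have KU : K <= U z by apply: le_trans Kk _; rewrite ltW// (lt_trans km).
  rewrite expr_div_n ler_pdivrMr ?exprn_gt0//; apply: le_trans (gbig z zi KU) _.
  have -> : eps * q ^+ 2 * trunc k z ^+ 2 * U z ^+ n = eps * (U z ^+ n * (q * trunc k z) ^+ 2).
    by ring.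
  rewrite -addn2 exprD ler_wpM2l// ler_wpM2l ?exprn_ge0// (Wk _ mU).
  rewrite lerXn2r ?nnegrE ?(ltW U0)//; last exact: qU.
  by rewrite mulr_ge0// subr_ge0 ltW// (lt_trans km).
have S0 : 0 <= \sum_z gam z * trunc k z ^+ 2.
  by apply: sumr_ge0 => z _; rewrite mulr_ge0 ?sqr_ge0.
have E3 : energy (trunc m) ^+ n <= (q * \sum_z gam z * trunc k z ^+ 2) ^+ n.
  by rewrite lerXn2r ?nnegrE ?energy_ge0// mulr_ge0.
have E4 := weighted_sobolev Ws gam0.
rewrite exprMn; apply: le_trans (ler_wpM2l _ E3) _; first by rewrite exprn_ge0// ltW.
rewrite exprMn; apply: le_trans (ler_wpM2l _ (ler_wpM2l _ E4)) _.
- by rewrite exprn_ge0// ltW.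
- by rewrite exprn_ge0.
have E5 : kap * cell * (\sum_z gam z ^+ n * ground z) <=
   kap * cell * (eps * q ^+ 2 * ((1 + kap * volume) * energy (trunc k))).
  by rewrite ler_wpM2l// mulr_ge0 ?(ltW kp0)// ltW.
apply: le_trans (ler_wpM2l _ (ler_wpM2l _ (ler_wpM2r _ E5))) _.
- by rewrite exprn_ge0// ltW.
- by rewrite exprn_ge0.
- by rewrite exprn_ge0.
rewrite -(addn2 n) exprD [(cell * _) ^+ n.+1]exprS [(cell * energy (trunc k)) ^+ n]exprMn.
rewrite -/(trunc k).
by rewrite le_eqVlt; apply: predU1l; ring.
Qed.

Lemma de_giorgi_bound (K eps Es : R) :
  0 < K -> 0 <= eps -> 0 < Es -> cell * energy U <= Es ->
  (forall z, inner z -> K <= U z -> g z ^+ n <= eps * U z ^+ n.+2) ->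
  (2 ^+ n.+2) ^+ 2 * (kap * (1 + kap * volume) * eps) * Es <= (2 ^+ n.+2)^-1 ^+ n ->
  forall z, U z <= 2 * K.
Proof.
move=> K0 e0 Es0 EU gbig small z; have c0 := cell_gt0.
(* The factor lost at step [j] is at most [b^(j+2)]; the same [b] serves as the decay rate of the
   energies. *)
set b : R := 2 ^+ n.+2 in small *.
have b0 : 0 < b by rewrite exprn_gt0.
pose lev (j : nat) : R := K * (2 - 2^-1 ^+ j).
have p0 (j : nat) : 0 < (2^-1 : R) ^+ j by rewrite exprn_gt0.
have p1 (j : nat) : (2^-1 : R) ^+ j <= 1 by apply: exprn_ile1; lra.
have levK (j : nat) : K <= lev j by rewrite /lev ler_peMr ?(ltW K0)//; have := p1 j; lra.
have levS (j : nat) : lev j < lev j.+1 by rewrite /lev ltr_pM2l// exprS; have := p0 j; lra.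
have D0 : 0 <= kap * (1 + kap * volume) * eps.
  have := kap_gt0; have := volume_gt0 => v0 k0.
  by rewrite mulr_ge0// mulr_ge0 ?(ltW k0)// addr_ge0// mulr_ge0// ltW.
have decay (j : nat) : cell * energy (trunc (lev j)) <= Es * b^-1 ^+ j.
  elim: j => [|j IH].
    rewrite expr0 mulr1; apply: le_trans EU.
    by rewrite ler_wpM2l ?(ltW c0)// truncation_energy_le.
  have e_ge0 k : 0 <= cell * energy (trunc k) by rewrite mulr_ge0 ?energy_ge0// ltW.
  rewrite -(@ler_pXn2r _ n)// ?nnegrE//; last first.
    by rewrite mulr_ge0 ?(ltW Es0)// exprn_ge0// invr_ge0 ltW.
  apply: le_trans (de_giorgi_step K0 e0 (levK j) (levS j) gbig) _.
  set D := kap * _ * _ in small D0 *.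
  set q := lev j.+1 / _.
  have q0 : 0 <= q.
    rewrite divr_ge0 ?subr_ge0 ?(ltW (levS j))//.
    by apply: le_trans (levK _); exact: ltW.
  (* The upper level is below [2 * K] and the gap between the levels is [K * 2^-(j+1)]. *)
  have qle : q <= 2 ^+ j.+2.
    rewrite ler_pdivrMr ?subr_gt0// /lev -mulrBr mulrCA ler_pM2l//.
    have -> : (2 : R) - 2^-1 ^+ j.+1 - (2 - 2^-1 ^+ j) = 2^-1 ^+ j / 2.
      by rewrite exprS; field.
    have -> : (2 : R) ^+ j.+2 * (2^-1 ^+ j / 2) = 2.
      by rewrite -[j.+2]addn2 exprD exprVn; field; rewrite expf_neq0.
    by have := p0 j.+1; lra.
  have qn : q ^+ n.+2 <= b ^+ 2 * b ^+ j.
    rewrite -exprD add2n /b -exprM mulnC exprM.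
    by rewrite lerXn2r ?nnegrE// exprn_ge0.
  have en : (cell * energy (trunc (lev j))) ^+ n.+1 <= (Es * b^-1 ^+ j) ^+ n.+1.
    by rewrite lerXn2r ?nnegrE// mulr_ge0 ?(ltW Es0)// exprn_ge0// invr_ge0 ltW.
  apply: le_trans (ler_pM _ _ (ler_wpM2r D0 qn) en) _.
  - by rewrite mulr_ge0// exprn_ge0.
  - by rewrite exprn_ge0.
  (* The surplus energy factor carries [b^-j] and cancels the growth [b^j]; what remains is the
     smallness assumption. *)
  have -> : b ^+ 2 * b ^+ j * D * (Es * b^-1 ^+ j) ^+ n.+1 =
      b ^+ 2 * D * Es * (Es * b^-1 ^+ j) ^+ n.
    rewrite [(Es * _) ^+ n.+1]exprS [b^-1 ^+ j]exprVn.
    by field; rewrite expf_neq0// gt_eqF.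
  rewrite [b^-1 ^+ j.+1]exprS [in leRHS]mulrCA [leRHS]exprMn.
  apply: ler_wpM2r => //.
  by rewrite exprn_ge0// mulr_ge0 ?(ltW Es0)// exprn_ge0// invr_ge0 ltW.
(* If [U z > 2 * K], all truncations are at least [d] at [z], against the decay of their energies.
   The factor [cell] is harmless here: the mesh is fixed while [j] grows. *)
rewrite leNgt; apply/negP => KU.
set d := U z - 2 * K.
have d0 : 0 < d by rewrite subr_gt0.
set P := 1 + kap * volume.
have P0 : 0 < P.
  by have := kap_gt0; have := volume_gt0; rewrite /P; nra.
have key (j : nat) : d ^+ 2 * cell * b ^+ j <= P * Es.
  have Ws : supported (trunc (lev j)).
    by apply: supported_truncation U_supp; apply: le_trans (levK j); exact: ltW.
  have h1 : d ^+ 2 <= \sum_z trunc (lev j) z ^+ 2.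
    rewrite (bigD1 z)//=; apply: le_trans (_ : trunc (lev j) z ^+ 2 <= _); last first.
      by rewrite lerDl sumr_ge0// => y _; exact: sqr_ge0.
    have dl : d <= U z - lev j.
      by rewrite /d /lev; have := p0 j; nra.
    rewrite /trunc max_l; last by apply: le_trans dl; exact: ltW.
    by rewrite lerXn2r ?nnegrE ?(ltW d0)// (le_trans _ dl)// ltW.
  have h2 := le_trans h1 (poincare Ws).
  have h3 : d ^+ 2 * cell <= P * (Es * b^-1 ^+ j).
    apply: le_trans (ler_wpM2r (ltW c0) h2) _.
    by rewrite -mulrA ler_wpM2l ?(ltW P0)// mulrC.
  apply: le_trans (ler_wpM2r _ h3) _; first by rewrite exprn_ge0// ltW.
  rewrite le_eqVlt; apply: predU1l.
  by rewrite exprVn; field; rewrite expf_neq0// gt_eqF.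
set t := d ^+ 2 * cell in key.
have t0 : 0 < t by rewrite mulr_gt0// exprn_gt0.
have := archi_boundP (divr_ge0 (mulr_ge0 (ltW P0) (ltW Es0)) (ltW t0)).
set j := Num.bound _; rewrite ltr_pdivrMr// => jb.
have := key j; rewrite leNgt => /negP; apply; apply: lt_le_trans jb _.
rewrite mulrC ler_pM2l// /b -exprM -natrX ler_nat.
apply: leq_trans (ltnW (ltn_expl j (isT : (1 < 2)%N))) _.
by rewrite leq_pexp2l// leq_pmull.
Qed.

End Torus.

(** * Consequences of the growth condition *)

Lemma superlinear_growth (R : realType) (n : nat) (C2 C3 p : R) : (2 <= n)%N ->
  0 < C2 -> 0 < C3 -> 1 < p -> p < n%:R / (n%:R - 1) ->
  forall eps, 0 < eps -> exists2 K, 1 <= K &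
    forall t s, K <= t -> 0 <= s -> s <= C2 * t `^ p + C3 ->
      s ^+ n.-1 <= eps * t ^+ n.
Proof.
move=> n2 C20 C30 p1 pn eps e0.
have nm : (n.-1%:R : R) = n%:R - 1 by rewrite -subn1 natrB//; lia.
have nm0 : (0 : R) < n.-1%:R by rewrite ltr0n; lia.
(* The condition [p < n/(n-1)] says exactly [d > 0]; a spare power [t^d] then absorbs the constant
   [A]. *)
pose d : R := n%:R - p * n.-1%:R.
have d0 : 0 < d by rewrite subr_gt0 -ltr_pdivlMr// nm.
pose A : R := (C2 + C3) ^+ n.-1 / eps.
have A0 : 0 < A by rewrite divr_gt0// exprn_gt0// addr_gt0.
exists (Num.max 1 (A `^ d^-1)); first by rewrite le_max lexx.
move=> t s; rewrite ge_max => /andP[t1 tA] s0 sle.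
have t0 : 0 < t by exact: lt_le_trans t1.
have tp1 : 1 <= t `^ p.
  by rewrite -(powRr0 t) ler_powR// (le_trans _ (ltW p1)).
have sle2 : s <= (C2 + C3) * t `^ p.
  by apply: le_trans sle _; rewrite mulrDl lerD2l ler_peMr// ltW.
have h1 : s ^+ n.-1 <= (C2 + C3) ^+ n.-1 * t `^ (p * n.-1%:R).
  rewrite powRrM powR_mulrn ?powR_ge0// -exprMn lerXn2r ?nnegrE//.
  by rewrite mulr_ge0 ?powR_ge0// ltW// addr_gt0.
have Ad : A <= t `^ d.
  have -> : A = (A `^ d^-1) `^ d by rewrite -powRrM mulVf ?gt_eqF// powRr1// ltW.
  by apply: ge0_ler_powR; rewrite ?nnegrE ?powR_ge0// ltW.
apply: le_trans h1 _.
have -> : t ^+ n = t `^ (p * n.-1%:R) * t `^ d.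
  rewrite -powRD; last by rewrite (gt_eqF t0) implybT.
  by rewrite /d addrC subrK powR_mulrn// ltW.
rewrite mulrCA mulrC ler_wpM2l ?powR_ge0//.
by rewrite mulrC -ler_pdivrMr.
Qed.

(** Since [n <= 2 * (n-1)], the bound on [s^(n-1)] forces [s <= t^2], and one more factor [s] may be
    multiplied in. This is the form needed by [de_giorgi_step]. *)
Lemma superlinear_square (R : realType) (n : nat) (eps s t : R) : (2 <= n)%N ->
  eps <= 1 -> 1 <= t -> 0 <= s -> s ^+ n.-1 <= eps * t ^+ n ->
  s ^+ n <= eps * t ^+ n.+2.
Proof.
move=> n2 e1 t1 s0 st.
have t0 : 0 <= t by exact: le_trans t1.
have sq : s <= t ^+ 2.
  rewrite -(@ler_pXn2r _ n.-1)// ?nnegrE ?sqr_ge0//; last by lia.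
  apply: le_trans st _; apply: le_trans (_ : t ^+ n <= _).
    by rewrite ler_piMl// exprn_ge0.
  by rewrite -exprM ler_weXn2l//; lia.
have -> : s ^+ n = s ^+ n.-1 * s by rewrite -exprSr prednK//; lia.
rewrite -addn2 exprD mulrA; apply: ler_pM => //; exact: exprn_ge0.
Qed.

(** * From the box to the torus *)

Section Transfer.
Variables (R : realType) (n : nat) (a b h : 'I_n -> R) (k l : 'I_n -> int).
Hypotheses (h_gt0 : forall i, 0 < h i)
  (akl : forall i, a i = (k i)%:~R * h i /\ b i = (l i)%:~R * h i /\ (1 < l i - k i)%R).

Definition cells i := `|l i - k i|%N.
(** A common side for all axes keeps the torus a plain type of finite functions; shorter axes have
    more spare layers. *)
Definition max_cells := \max_i cells i.
Notation N := max_cells.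
Notation grid := {ffun 'I_n -> 'I_N.+1}.
Implicit Types z : grid.

Definition point (z : grid) : gpoint R n := [ffun i => a i + (z i)%:R * h i].

Definition extend (u : gpoint R n -> R) (z : grid) : R :=
  if inner cells z then u (point z) else 0.

Lemma cells_gt1 i : (1 < cells i)%N.
Proof. by rewrite /cells; have [_ [_ ?]] := akl i; lia. Qed.

Lemma cells_le i : (cells i <= N)%N.
Proof. exact: leq_bigmax. Qed.

Lemma len_box i : len cells h i = b i - a i.
Proof.
have [-> [-> lk]] := akl i.
by rewrite /len /cells -mulrBl -intrB natr_absz ger0_norm//; lia.
Qed.

Lemma point_cl z : (forall i, (z i <= cells i)%N) -> grid_cl a b h (point z).
Proof.
move=> zM; split=> [i|].
  rewrite ffunE lerDl mulr_ge0 ?(ltW (h_gt0 i))//= -lerBrDl -len_box /len.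
  by rewrite ler_wpM2r ?(ltW (h_gt0 i))// ler_nat.
exists (fun i => k i + (z i)%:Z) => i; have [aE _] := akl i.
by rewrite ffunE aE intrD mulrDl.
Qed.

Lemma point_in_box z : inner cells z -> in_box a b (point z).
Proof.
move=> /forallP zi i; have /andP[z0 zM] := zi i.
rewrite ffunE ltrDl mulr_gt0 ?ltr0n//= -ltrBrDl -len_box /len.
by rewrite ltr_pM2r// ltr_nat.
Qed.

Lemma inner_le z i : inner cells z -> (z i <= cells i)%N.
Proof. by move=> /forallP/(_ i)/andP[_ /ltnW]. Qed.

Lemma point_int z : inner cells z -> grid_int a b h (point z).
Proof.
move=> zi; split; first exact: point_in_box.
by case: (point_cl (fun i => inner_le i zi)).
Qed.

Lemma point_bd z : (forall i, (z i <= cells i)%N) -> ~~ inner cells z ->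
  grid_bd a b h (point z).
Proof.
move=> zM /forallPn[i zi]; have [zc zl] := point_cl zM; split=> //; split=> // /(_ i).
rewrite ffunE ltrDl pmulr_lgt0// ltr0n -ltrBrDl -len_box /len ltr_pM2r// ltr_nat.
exact/negP.
Qed.

Lemma point_surj x : grid_cl a b h x ->
  exists2 z : grid, (forall i, (z i <= cells i)%N) & point z = x.
Proof.
move=> [xc [m xm]].
have mb i : (k i <= m i <= l i)%R.
  have := xc i; rewrite xm; have [-> [-> _]] := akl i.
  by rewrite !ler_pM2r// !ler_int.
have zi i : (`|m i - k i| <= cells i)%N by rewrite /cells; have := mb i; lia.
have zN i : (`|m i - k i| < N.+1)%N by rewrite ltnS (leq_trans (zi i))// cells_le.
exists [ffun i => Ordinal (zN i)] => [i|]; first by rewrite ffunE; exact: zi.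
apply/ffunP => i; rewrite !ffunE/= xm; have [-> _] := akl i.
rewrite natr_absz ger0_norm; last by have := mb i; lia.
by rewrite intrB mulrBl addrCA subrr addr0.
Qed.

Variable u : gpoint R n -> R.
Hypothesis u_bd : forall x, grid_bd a b h x -> u x = 0.

(** The boundary condition makes the zero extension agree with [u] on the closed box, which contains
    all neighbours of inner points. *)
Lemma extendE z : (forall i, (z i <= cells i)%N) -> extend u z = u (point z).
Proof.
by move=> zM; rewrite /extend; case: ifPn => // /(point_bd zM)/u_bd ->.
Qed.

Lemma lap_extend z : inner cells z -> lap h (extend u) z = lap_h h u (point z).
Proof.
move=> zi; have zl i := inner_le i zi.
have zN i : (z i < N)%N.
  by have /forallP/(_ i)/andP[_ zM] := zi; exact: leq_trans zM (cells_le i).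
have z0 i : (0 < z i)%N by have /forallP/(_ i)/andP[] := zi.
apply: eq_bigr => i _; congr ((_ - 2 * _ + _) / _).
- rewrite extendE => [|j]; last first.
    rewrite (unit_vecE cells_gt1 cells_le)//; case: eqP => // _.
    by have /forallP/(_ j)/andP[_ zM] := zi.
  congr u; apply/ffunP => j; rewrite [LHS]ffunE (unit_vecE cells_gt1 cells_le)//.
  rewrite !ffunE; case: (j =P i) => [->|_]; last by rewrite addr0.
  by rewrite -natr1 mulrDl mul1r addrA.
- exact: extendE.
- rewrite extendE => [|j]; last first.
    rewrite (unit_vecN cells_gt1 cells_le)//; case: eqP => // _.
    exact: leq_trans (leq_pred _) (zl j).
  congr u; apply/ffunP => j; rewrite [LHS]ffunE (unit_vecN cells_gt1 cells_le)//.
  rewrite !ffunE; case: (j =P i) => [->|_]; last by rewrite addr0.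
  by rewrite -[in RHS](prednK (z0 i)) -natr1 mulrDl mul1r -addrA addrK.
Qed.

End Transfer.

Theorem mainTheorem2 (R : realType) (n : nat) (a b : 'I_n -> R)
    (C1 C2 C3 lam p : R) (f : gpoint R n -> R -> R) :
  (2 <= n)%N ->
  (forall i, a i < b i) ->
  0 < C1 -> 0 < C2 -> 0 < C3 ->
  (forall x s, in_box a b x -> 0 <= s -> 0 <= f x s) ->
  lambda1 a b < lam ->
  (forall x s, in_box a b x -> 0 <= s -> lam * s - C1 <= f x s) ->
  1 < p -> p < n%:R / (n%:R - 1) ->
  (forall x s, in_box a b x -> 0 <= s -> f x s <= C2 * s `^ p + C3) ->
  exists Mbar : R,
    forall h : 'I_n -> R, admissible a b h ->
    forall u : gpoint R n -> R,
      (forall x, grid_cl a b h x -> 0 <= u x) ->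
      (forall x, grid_int a b h x -> - lap_h h u x = f x (u x)) ->
      (forall x, grid_bd a b h x -> u x = 0) ->
      forall x, grid_cl a b h x -> `|u x| <= Mbar.
Proof.
move=> n2 ab C10 C20 C30 f0 llam flow p1 pn fup.
have n0 : (0 < n)%N by lia.
have growth := superlinear_growth n2 C20 C30 p1 pn.
(* These are [volume] and [kap] in terms of the box alone; every constant is fixed before [h] is
   introduced. *)
pose vol := \prod_i (b i - a i); pose kp := \prod_i (4 * (b i - a i)).
have vol0 : 0 < vol by apply: prodr_gt0 => i _; rewrite subr_gt0.
have kp0 : 0 < kp by apply: prodr_gt0 => i _; rewrite mulr_gt0// subr_gt0.
have l0 : 0 <= lambda1 a b.
  by apply: sumr_ge0 => i _; rewrite divr_ge0 ?sqr_ge0.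
pose Q := lambda1 a b * (C1 * vol / (lam - lambda1 a b)).
have Q0 : 0 <= Q.
  by rewrite mulr_ge0// divr_ge0 ?subr_ge0 ?(ltW llam)// mulr_ge0 ?(ltW C10)// ltW.
(* Chosen for the absorption in [energy_bound]; [Q + 1] is positive from [0 <= Q] alone. *)
pose eps1 := 2^-1 ^+ n / (kp * (Q + 1)).
have kQ : 0 < kp * (Q + 1) by rewrite mulr_gt0// ltr_wpDl.
have eps10 : 0 < eps1 by rewrite divr_gt0// exprn_gt0.
have [K1 K1_ge1 big1] := growth eps1 eps10.
have K10 : 0 < K1 by exact: lt_le_trans K1_ge1.
pose B := C2 * K1 `^ p + C3.
have B0 : 0 < B by rewrite addr_gt0// mulr_gt0// powR_gt0.
pose Es := 2 * (vol * (B * K1)).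
have Es0 : 0 < Es by rewrite !mulr_gt0.
pose D := kp * (1 + kp * vol).
have D0 : 0 < D by rewrite mulr_gt0// addr_gt0// mulr_gt0.
pose d : R := 2 ^+ n.+2.
have d0 : 0 < d by rewrite exprn_gt0.
have dDE : 0 < d ^+ 2 * D * Es by rewrite mulr_gt0 // mulr_gt0 // exprn_gt0.
(* The bound by 1 serves [superlinear_square], the other entry is the smallness in
   [de_giorgi_bound]. *)
pose eps2 := Num.min 1 (d^-1 ^+ n / (d ^+ 2 * D * Es)).
have eps20 : 0 < eps2 by rewrite lt_min ltr01 divr_gt0// exprn_gt0// invr_gt0.
have eps21 : eps2 <= 1 by rewrite ge_min lexx.
have [K2 K2_ge1 big2] := growth eps2 eps20.
have K20 : 0 < K2 by exact: lt_le_trans K2_ge1.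
exists (2 * K2) => h [h0 [k [l akl]]] u u0 ueq ubd x xcl.
rewrite ger0_norm ?u0//.
have [z zM <-] := point_surj h0 akl xcl.
rewrite -(extendE h0 akl ubd zM).
pose M := cells k l.
have M1 : forall i, (1 < M i)%N := cells_gt1 akl.
have MN : forall i, (M i <= max_cells k l)%N := cells_le k l.
have volE : volume M h = vol by apply: eq_bigr => i _; exact: len_box.
have kpE : kap M h = kp by apply: eq_bigr => i _; rewrite (len_box akl).
set U := extend a h u.
(* The hypotheses on [f] hold inside the box only, hence the value 0 elsewhere. *)
pose g y := if inner M y then f (point a h y) (U y) else 0.
have U0 y : 0 <= U y.
  rewrite /U /extend; case: ifP => // yi; apply: u0.
  exact: (point_cl h0 akl (fun i => inner_le i yi)).
have Us : supported M U by move=> y /negPf yi; rewrite /U /extend yi.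
have g0 y : 0 <= g y.
  by rewrite /g; case: ifP => // yi; apply: f0 => //; exact: (point_in_box h0 akl yi).
have Ueq y : inner M y -> - lap h U y = g y.
  move=> yi; rewrite (lap_extend h0 akl ubd yi) ueq; last exact: point_int.
  by rewrite /g yi /U /extend yi.
have gup y : inner M y -> g y <= C2 * U y `^ p + C3.
  by move=> yi; rewrite /g yi; apply: fup => //; exact: (point_in_box h0 akl yi).
have glow y : inner M y -> lam * U y - C1 <= g y.
  by move=> yi; rewrite /g yi; apply: flow => //; exact: (point_in_box h0 akl yi).
have lamE : \sum_i pi ^+ 2 / len M h i ^+ 2 <= lambda1 a b.
  by rewrite le_eqVlt; apply: predU1l; apply: eq_bigr => i _; rewrite (len_box akl).
have gQ := weighted_l1_bound M1 MN h0 U0 Us Ueq (ltW C10) l0 lamE llam glow.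
rewrite volE -/Q in gQ.
have small1 : kap M h * eps1 * Q <= 2^-1 ^+ n.
  rewrite kpE /eps1.
  have c0 : 0 <= (2^-1 : R) ^+ n by rewrite exprn_ge0.
  move: (2^-1 ^+ n) c0 => c c0.
  have -> : kp * (c / (kp * (Q + 1))) * Q = c * (Q / (Q + 1)).
    by field; rewrite !gt_eqF// ltr_wpDl.
  by rewrite ler_piMr// ler_pdivrMr ?ltr_wpDl// mul1r lerDl.
have gbig1 y : inner M y -> K1 <= U y -> g y ^+ n.-1 <= eps1 * U y ^+ n.
  by move=> yi KU; apply: big1 => //; exact: gup.
have gsmall y : inner M y -> U y <= K1 -> g y <= B.
  move=> yi UK; apply: le_trans (gup y yi) _; rewrite lerD2r ler_wpM2l ?(ltW C20)//.
  by apply: ge0_ler_powR; rewrite ?nnegrE ?(ltW K10)// (le_trans ler01)// ltW.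
have EU := energy_bound M1 MN h0 U0 Us g0 Ueq n0 K10 (ltW eps10) (ltW B0) gQ gbig1 gsmall small1.
rewrite volE -/Es in EU.
have gbig2 y : inner M y -> K2 <= U y -> g y ^+ n <= eps2 * U y ^+ n.+2.
  move=> yi KU; apply: superlinear_square => //; first exact: le_trans KU.
  by apply: big2 => //; exact: gup.
apply: (de_giorgi_bound M1 MN h0 U0 Us g0 Ueq n0 K20 (ltW eps20) Es0 EU gbig2).
rewrite kpE volE -/D -/d.
have -> : d ^+ 2 * (D * eps2) * Es = eps2 * (d ^+ 2 * D * Es) by ring.
by rewrite -ler_pdivlMr// ge_min lexx orbT.
Qed.
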